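(* Let $(\mathcal{C},\otimes,1)$ be a monoidal category with finite products such that the unit $1$ is a left $\otimes$-generator; assume moreover that $\mathcal{C}$ has coequalizers and that every object of $(\mathcal{C},\otimes,1)$ is coflat. Suppose $f_1:R_1\to S_1$ and $f_2:R_2\to S_2$ are algebra morphisms in $\mathcal{C}$ such that $f_1^*=-\otimes_{R_1}S_1$ and $f_2^*=-\otimes_{R_2}S_2$ are semiseparable (resp., separable, naturally full). Then $(f_1\times f_2)^*=-\otimes_{R_1\times R_2}(S_1\times S_2):\mathcal{C}_{R_1\times R_2}\to\mathcal{C}_{S_1\times S_2}$ is also semiseparable (resp., separable, naturally full).
   Context: Associativity and unit constraints are suppressed. For algebras $(A,m_A,u_A)$, $(B,m_B,u_B)$ in $(\mathcal{C},\otimes,1)$, the categorical product $A\times B$ is an algebra with multiplication $(m_A\times m_B)\circ\langle p_A\otimes p_A,\,p_B\otimes p_B\rangle:(A\times B)\otimes(A\times B)\to A\times B$, where $p_A,p_B$ are the projections, and unit $\langle u_A,u_B\rangle:1\to A\times B$; products of algebra morphisms are algebra morphisms. For an algebra $A$, $\mathcal{C}_A$ (resp. ${}_A\mathcal{C}$) is the category of right (resp. left) $A$-modules in $(\mathcal{C},\otimes,1)$. An object $X$ is coflat if both $X\otimes-$ and $-\otimes X$ preserve coequalizers. For $M\in\mathcal{C}_A$ with action $\nu$ and $X\in{}_A\mathcal{C}$ with action $\mu$, $q^A_{M,X}:M\otimes X\to M\otimes_A X$ is the coequalizer of $\nu\otimes\mathrm{Id}_X$ and $\mathrm{Id}_M\otimes\mu$.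 For an algebra morphism $f:R\to S$, $S$ is a left $R$-module via $m_S(f\otimes\mathrm{Id}_S)$, and the induction functor $f^*=-\otimes_R S:\mathcal{C}_R\to\mathcal{C}_S$ sends $X$ to $X\otimes_R S$ with right $S$-action induced by $m_S$, and $h:X\to Y$ to the unique morphism $h\otimes_R S$ with $(h\otimes_R S)q^R_{X,S}=q^R_{Y,S}(h\otimes\mathrm{Id}_S)$. An object $P$ is a left $\otimes$-generator of $\mathcal{C}$ if for any morphisms $f,g:Y\otimes Z\to W$ with $f(\varepsilon\otimes\mathrm{Id}_Z)=g(\varepsilon\otimes\mathrm{Id}_Z)$ for all $\varepsilon:P\to Y$, one has $f=g$. A functor $F:\mathcal{A}\to\mathcal{B}$ induces the natural transformation $\mathcal{F}:\mathrm{Hom}_{\mathcal{A}}(-,-)\to\mathrm{Hom}_{\mathcal{B}}(F-,F-)$, $f\mapsto F(f)$. $F$ is separable (resp. naturally full, semiseparable) if there is a natural transformation $\mathcal{P}:\mathrm{Hom}_{\mathcal{B}}(F-,F-)\to\mathrm{Hom}_{\mathcal{A}}(-,-)$ with $\mathcal{P}\circ\mathcal{F}=\mathrm{Id}$ (resp. $\mathcal{F}\circ\mathcal{P}=\mathrm{Id}$, $\mathcal{F}\circ\mathcal{P}\circ\mathcal{F}=\mathcal{F}$). *)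

(* Defs.v *)
From Corelib Require Import ssreflect.
From Stdlib Require Import ProofIrrelevance.

Set Implicit Arguments.
Unset Strict Implicit.
Unset Printing Implicit Defensive.

Reserved Notation "g ∘ f" (at level 39, right associativity).
Reserved Notation "A ⊗ B" (at level 36, right associativity).
Reserved Notation "f ⊠ g" (at level 36, right associativity).

Record Category := {
  ob :> Type;
  hom : ob -> ob -> Type;
  idm : forall X, hom X X;
  comp : forall X Y Z, hom Y Z -> hom X Y -> hom X Z;
  comp_idl : forall X Y (f : hom X Y), comp (idm Y) f = f;
  comp_idr : forall X Y (f : hom X Y), comp f (idm X) = f;
  compA : forall X Y Z W (h : hom Z W) (g : hom Y Z) (f : hom X Y),
    comp h (comp g f) = comp (comp h g) f
}.
Arguments hom {c} X Y.
Arguments idm {c} X.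
Arguments comp {c X Y Z} g f : rename.

Notation "g ∘ f" := (comp g f).

Record Functor (A B : Category) := {
  fob :> A -> B;
  fmap : forall X Y, hom X Y -> hom (fob X) (fob Y);
  fmap_id : forall X, fmap (idm X) = idm (fob X);
  fmap_comp : forall X Y Z (g : hom Y Z) (f : hom X Y),
    fmap (g ∘ f) = fmap g ∘ fmap f
}.
Arguments fmap {A B} F {X Y} f : rename.

Definition hom_retrofamily (A B : Category) (F : Functor A B) : Type :=
  forall X Y : A, hom (F X) (F Y) -> hom X Y.

(* Naturality, in both variables, of P : Hom_B(F -, F -) -> Hom_A(-, -) as a
   transformation of functors A^op x A -> Set. *)
Definition is_natural (A B : Category) (F : Functor A B)
    (P : hom_retrofamily F) : Prop :=
  forall (X X' Y Y' : A) (h : hom X' X) (k : hom Y Y') (g : hom (F X) (F Y)),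
    P X' Y' (fmap F k ∘ g ∘ fmap F h) = k ∘ P X Y g ∘ h.

Definition separable (A B : Category) (F : Functor A B) : Prop :=
  exists P : hom_retrofamily F, is_natural P /\
    forall (X Y : A) (f : hom X Y), P X Y (fmap F f) = f.

Definition naturally_full (A B : Category) (F : Functor A B) : Prop :=
  exists P : hom_retrofamily F, is_natural P /\
    forall (X Y : A) (g : hom (F X) (F Y)), fmap F (P X Y g) = g.

Definition semiseparable (A B : Category) (F : Functor A B) : Prop :=
  exists P : hom_retrofamily F, is_natural P /\
    forall (X Y : A) (f : hom X Y), fmap F (P X Y (fmap F f)) = fmap F f.

Record FiniteProducts (C : Category) := {
  terminal : C;
  to_terminal : forall X : C, hom X terminal;
  to_terminal_uniq : forall (X : C) (f : hom X terminal), f = to_terminal X;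
  bprod : C -> C -> C;
  pr1 : forall A B : C, hom (bprod A B) A;
  pr2 : forall A B : C, hom (bprod A B) B;
  bpair : forall A B X : C, hom X A -> hom X B -> hom X (bprod A B);
  pr1_pair : forall (A B X : C) (f : hom X A) (g : hom X B),
    pr1 A B ∘ bpair f g = f;
  pr2_pair : forall (A B X : C) (f : hom X A) (g : hom X B),
    pr2 A B ∘ bpair f g = g;
  pair_uniq : forall (A B X : C) (h : hom X (bprod A B)),
    h = bpair (pr1 A B ∘ h) (pr2 A B ∘ h)
}.
Arguments bprod {C} fp A B : rename.
Arguments pr1 {C} fp A B : rename.
Arguments pr2 {C} fp A B : rename.
Arguments bpair {C} fp {A B X} f g : rename.

Definition prodm (C : Category) (fp : FiniteProducts C) (A A' B B' : C)
    (f : hom A A') (g : hom B B') : hom (bprod fp A B) (bprod fp A' B') :=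
  bpair fp (f ∘ pr1 fp A B) (g ∘ pr2 fp A B).

(* The factorization [coeq_desc] is carried as data, which costs nothing since
   [coeq_uniq] determines it; the record therefore lives in Type. *)
Record IsCoequalizer (C : Category) (X Y Q : C) (f g : hom X Y)
    (q : hom Y Q) : Type := {
  coeq_eq : q ∘ f = q ∘ g;
  coeq_desc : forall (Z : C) (h : hom Y Z), h ∘ f = h ∘ g -> hom Q Z;
  coeq_fac : forall (Z : C) (h : hom Y Z) (e : h ∘ f = h ∘ g),
    coeq_desc e ∘ q = h;
  coeq_uniq : forall (Z : C) (u v : hom Q Z), u ∘ q = v ∘ q -> u = v
}.

Record Coequalizers (C : Category) := {
  coeq_ob : forall X Y : C, hom X Y -> hom X Y -> C;
  coeq_map : forall (X Y : C) (f g : hom X Y), hom Y (coeq_ob f g);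
  coeqP : forall (X Y : C) (f g : hom X Y), IsCoequalizer f g (coeq_map f g)
}.

Record MonoidalCategory := {
  mcat :> Category;
  tens : mcat -> mcat -> mcat;
  tensm : forall A A' B B' : mcat,
    hom A A' -> hom B B' -> hom (tens A B) (tens A' B');
  munit : mcat;
  tens_id : forall A B : mcat, tensm (idm A) (idm B) = idm (tens A B);
  tens_comp : forall (A A' A'' B B' B'' : mcat)
      (f' : hom A' A'') (f : hom A A') (g' : hom B' B'') (g : hom B B'),
    tensm f' g' ∘ tensm f g = tensm (f' ∘ f) (g' ∘ g);
  assoc : forall A B C : mcat, hom (tens (tens A B) C) (tens A (tens B C));
  assoc_inv : forall A B C : mcat, hom (tens A (tens B C)) (tens (tens A B) C);
  assocK : forall A B C, assoc_inv A B C ∘ assoc A B C = idm _;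
  assoc_invK : forall A B C, assoc A B C ∘ assoc_inv A B C = idm _;
  assoc_nat : forall (A A' B B' C C' : mcat)
      (f : hom A A') (g : hom B B') (h : hom C C'),
    assoc A' B' C' ∘ tensm (tensm f g) h = tensm f (tensm g h) ∘ assoc A B C;
  lunit : forall A : mcat, hom (tens munit A) A;
  lunit_inv : forall A : mcat, hom A (tens munit A);
  lunitK : forall A, lunit_inv A ∘ lunit A = idm _;
  lunit_invK : forall A, lunit A ∘ lunit_inv A = idm _;
  lunit_nat : forall (A B : mcat) (f : hom A B),
    lunit B ∘ tensm (idm munit) f = f ∘ lunit A;
  runit : forall A : mcat, hom (tens A munit) A;
  runit_inv : forall A : mcat, hom A (tens A munit);
  runitK : forall A, runit_inv A ∘ runit A = idm _;
  runit_invK : forall A, runit A ∘ runit_inv A = idm _;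
  runit_nat : forall (A B : mcat) (f : hom A B),
    runit B ∘ tensm f (idm munit) = f ∘ runit A;
  pentagon : forall A B C D : mcat,
    tensm (idm A) (assoc B C D) ∘ assoc A (tens B C) D
      ∘ tensm (assoc A B C) (idm D)
    = assoc A B (tens C D) ∘ assoc (tens A B) C D;
  triangle : forall A B : mcat,
    tensm (idm A) (lunit B) ∘ assoc A munit B = tensm (runit A) (idm B)
}.
Arguments tens {m} A B : rename.
Arguments tensm {m A A' B B'} f g : rename.
Arguments assoc {m} A B C : rename.
Arguments assoc_inv {m} A B C : rename.
Arguments lunit {m} A : rename.
Arguments runit {m} A : rename.

Notation "A ⊗ B" := (tens A B).
Notation "f ⊠ g" := (tensm f g).

Definition left_tensor_generator (C : MonoidalCategory) (P : C) : Prop :=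
  forall (Y Z W : C) (f g : hom (Y ⊗ Z) W),
    (forall e : hom P Y, f ∘ (e ⊠ idm Z) = g ∘ (e ⊠ idm Z)) -> f = g.

Record Coflat (C : MonoidalCategory) (X : C) : Type := {
  coflat_l : forall (A B Q : C) (f g : hom A B) (q : hom B Q),
    IsCoequalizer f g q ->
    IsCoequalizer (idm X ⊠ f) (idm X ⊠ g) (idm X ⊠ q);
  coflat_r : forall (A B Q : C) (f g : hom A B) (q : hom B Q),
    IsCoequalizer f g q ->
    IsCoequalizer (f ⊠ idm X) (g ⊠ idm X) (q ⊠ idm X)
}.

Lemma tens_idl (C : MonoidalCategory) (X A B D : C)
    (g : hom B D) (f : hom A B) :
  (idm X ⊠ g) ∘ (idm X ⊠ f) = idm X ⊠ (g ∘ f).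
Proof. by rewrite tens_comp comp_idl. Qed.

Lemma tens_idr (C : MonoidalCategory) (X A B D : C)
    (g : hom B D) (f : hom A B) :
  (g ⊠ idm X) ∘ (f ⊠ idm X) = (g ∘ f) ⊠ idm X.
Proof. by rewrite tens_comp comp_idl. Qed.

Lemma tens_swap (C : MonoidalCategory) (A A' B B' : C)
    (f : hom A A') (g : hom B B') :
  (idm A' ⊠ g) ∘ (f ⊠ idm B) = (f ⊠ idm B') ∘ (idm A ⊠ g).
Proof. by rewrite !tens_comp !comp_idl !comp_idr. Qed.

Lemma runit_tens (C : MonoidalCategory) (X Y : C) :
  (idm X ⊠ runit Y) ∘ assoc X Y (munit C) = runit (X ⊗ Y).
Proof.
have faithful (A B : C) (f g : hom A B) :
    f ⊠ idm (munit C) = g ⊠ idm (munit C) -> f = g.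
  move=> e.
  rewrite -(comp_idr f) -(comp_idr g) -runit_invK !compA.
  by rewrite -!runit_nat e.
apply: faithful.
have cancel (A : C) (f g : hom A ((X ⊗ Y) ⊗ munit C)) :
    assoc X Y (munit C) ∘ f = assoc X Y (munit C) ∘ g -> f = g.
  move=> e.
  by rewrite -(comp_idl f) -(comp_idl g) -(assocK X Y (munit C)) -!compA e.
apply: cancel.
rewrite -tens_idr compA assoc_nat -!triangle -tens_idl -!compA pentagon !compA.
by rewrite -assoc_nat tens_id.
Qed.

Record Algebra (C : MonoidalCategory) := {
  alg :> C;
  mul : hom (alg ⊗ alg) alg;
  one : hom (munit C) alg;
  mulA : mul ∘ (mul ⊠ idm alg) = mul ∘ (idm alg ⊠ mul) ∘ assoc alg alg alg;
  mul1l : mul ∘ (one ⊠ idm alg) = lunit alg;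
  mul1r : mul ∘ (idm alg ⊠ one) = runit alg
}.
Arguments mul {C} A : rename.
Arguments one {C} A : rename.

Record AlgHom (C : MonoidalCategory) (A B : Algebra C) := {
  amor :> hom A B;
  amor_mul : amor ∘ mul A = mul B ∘ (amor ⊠ amor);
  amor_one : amor ∘ one A = one B
}.

Record RightModule (C : MonoidalCategory) (A : Algebra C) := {
  rcar :> C;
  ract : hom (rcar ⊗ A) rcar;
  ractA : ract ∘ (ract ⊠ idm A) = ract ∘ (idm rcar ⊠ mul A) ∘ assoc rcar A A;
  ract1 : ract ∘ (idm rcar ⊠ one A) = runit rcar
}.
Arguments ract {C A} M : rename.

Record LeftModule (C : MonoidalCategory) (A : Algebra C) := {
  lcar :> C;
  lact : hom (A ⊗ lcar) lcar;
  lactA : lact ∘ (mul A ⊠ idm lcar) = lact ∘ (idm A ⊠ lact) ∘ assoc A A lcar;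
  lact1 : lact ∘ (one A ⊠ idm lcar) = lunit lcar
}.
Arguments lact {C A} X : rename.

Record RModHom (C : MonoidalCategory) (A : Algebra C) (M N : RightModule A) := {
  rmor :> hom M N;
  rmor_act : rmor ∘ ract M = ract N ∘ (rmor ⊠ idm A)
}.

Lemma RModHom_eq (C : MonoidalCategory) (A : Algebra C) (M N : RightModule A)
    (f g : RModHom M N) : rmor f = rmor g -> f = g.
Proof.
case: f g => [f ef] [g eg] /= efg; subst g.
by rewrite (proof_irrelevance _ ef eg).
Qed.

Definition rmod_id (C : MonoidalCategory) (A : Algebra C) (M : RightModule A) :
  RModHom M M.
Proof.
exists (idm M).
abstract by rewrite comp_idl tens_id comp_idr.
Defined.

Definition rmod_comp (C : MonoidalCategory) (A : Algebra C)
    (M N L : RightModule A) (g : RModHom N L) (f : RModHom M N) : RModHom M L.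
Proof.
exists (rmor g ∘ rmor f).
abstract by rewrite -compA rmor_act compA rmor_act -compA tens_idr.
Defined.

Definition RMod (C : MonoidalCategory) (A : Algebra C) : Category.
Proof.
refine {| ob := RightModule A; hom := @RModHom C A;
          idm := @rmod_id C A; comp := @rmod_comp C A |}.
- abstract by move=> *; apply: RModHom_eq; exact: comp_idl.
- abstract by move=> *; apply: RModHom_eq; exact: comp_idr.
- abstract by move=> *; apply: RModHom_eq; exact: compA.
Defined.

Lemma pair_ext (C : Category) (fp : FiniteProducts C) (A B X : C)
    (f g : hom X (bprod fp A B)) :
  pr1 fp A B ∘ f = pr1 fp A B ∘ g -> pr2 fp A B ∘ f = pr2 fp A B ∘ g -> f = g.
Proof. by move=> e1 e2; rewrite (pair_uniq f) (pair_uniq g) e1 e2. Qed.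

Definition prod_mul (C : MonoidalCategory) (fp : FiniteProducts C)
    (A B : Algebra C) : hom (bprod fp A B ⊗ bprod fp A B) (bprod fp A B) :=
  prodm fp (mul A) (mul B)
    ∘ bpair fp (pr1 fp A B ⊠ pr1 fp A B) (pr2 fp A B ⊠ pr2 fp A B).

Definition prod_one (C : MonoidalCategory) (fp : FiniteProducts C)
    (A B : Algebra C) : hom (munit C) (bprod fp A B) :=
  bpair fp (one A) (one B).

Lemma pr1_mul (C : MonoidalCategory) (fp : FiniteProducts C)
    (A B : Algebra C) :
  pr1 fp A B ∘ prod_mul fp A B = mul A ∘ (pr1 fp A B ⊠ pr1 fp A B).
Proof. by rewrite /prod_mul /prodm compA pr1_pair -compA pr1_pair. Qed.

Lemma pr2_mul (C : MonoidalCategory) (fp : FiniteProducts C)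
    (A B : Algebra C) :
  pr2 fp A B ∘ prod_mul fp A B = mul B ∘ (pr2 fp A B ⊠ pr2 fp A B).
Proof. by rewrite /prod_mul /prodm compA pr2_pair -compA pr2_pair. Qed.

Lemma mulA_along (C : MonoidalCategory) (A : Algebra C) (X : C)
    (m : hom (X ⊗ X) X) (p : hom X A) :
  p ∘ m = mul A ∘ (p ⊠ p) ->
  p ∘ m ∘ (m ⊠ idm X) = p ∘ m ∘ (idm X ⊠ m) ∘ assoc X X X.
Proof.
move=> pm; rewrite compA pm -compA tens_comp comp_idr pm.
rewrite -[X in _ ∘ (_ ⊠ X)]comp_idl -tens_comp compA mulA -!compA assoc_nat.
rewrite [in RHS]compA [in RHS]pm -[in RHS]compA; congr (_ ∘ _).
by rewrite !compA !tens_comp comp_idl comp_idr pm.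
Qed.

Lemma mul1l_along (C : MonoidalCategory) (A : Algebra C) (X : C)
    (m : hom (X ⊗ X) X) (u : hom (munit C) X) (p : hom X A) :
  p ∘ m = mul A ∘ (p ⊠ p) -> p ∘ u = one A ->
  p ∘ m ∘ (u ⊠ idm X) = p ∘ lunit X.
Proof.
move=> pm pu; rewrite compA pm -compA tens_comp pu comp_idr -lunit_nat -mul1l.
by rewrite -compA tens_comp comp_idr comp_idl.
Qed.

Lemma mul1r_along (C : MonoidalCategory) (A : Algebra C) (X : C)
    (m : hom (X ⊗ X) X) (u : hom (munit C) X) (p : hom X A) :
  p ∘ m = mul A ∘ (p ⊠ p) -> p ∘ u = one A ->
  p ∘ m ∘ (idm X ⊠ u) = p ∘ runit X.
Proof.
move=> pm pu; rewrite compA pm -compA tens_comp pu comp_idr -runit_nat -mul1r.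
by rewrite -compA tens_comp comp_idr comp_idl.
Qed.

Definition prod_alg (C : MonoidalCategory) (fp : FiniteProducts C)
    (A B : Algebra C) : Algebra C.
Proof.
refine {| alg := bprod fp A B; mul := prod_mul fp A B; one := prod_one fp A B |}.
- abstract (apply: pair_ext;
    [exact: (mulA_along (pr1_mul fp A B))
    |exact: (mulA_along (pr2_mul fp A B))]).
- abstract (apply: pair_ext;
    [exact: (mul1l_along (pr1_mul fp A B) (pr1_pair fp (one A) (one B)))
    |exact: (mul1l_along (pr2_mul fp A B) (pr2_pair fp (one A) (one B)))]).
- abstract (apply: pair_ext;
    [exact: (mul1r_along (pr1_mul fp A B) (pr1_pair fp (one A) (one B)))
    |exact: (mul1r_along (pr2_mul fp A B) (pr2_pair fp (one A) (one B)))]).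
Defined.

Lemma prodm_amor_mul (C : MonoidalCategory) (fp : FiniteProducts C)
    (R1 S1 R2 S2 : Algebra C) (f1 : AlgHom R1 S1) (f2 : AlgHom R2 S2) :
  prodm fp (amor f1) (amor f2) ∘ prod_mul fp R1 R2
  = prod_mul fp S1 S2
      ∘ (prodm fp (amor f1) (amor f2) ⊠ prodm fp (amor f1) (amor f2)).
Proof.
apply: pair_ext; rewrite [in LHS]compA [in RHS]compA.
- rewrite pr1_mul -[in RHS]compA tens_comp /prodm !pr1_pair.
  by rewrite -compA pr1_mul compA amor_mul -compA tens_comp.
- rewrite pr2_mul -[in RHS]compA tens_comp /prodm !pr2_pair.
  by rewrite -compA pr2_mul compA amor_mul -compA tens_comp.
Qed.

Lemma prodm_amor_one (C : MonoidalCategory) (fp : FiniteProducts C)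
    (R1 S1 R2 S2 : Algebra C) (f1 : AlgHom R1 S1) (f2 : AlgHom R2 S2) :
  prodm fp (amor f1) (amor f2) ∘ prod_one fp R1 R2 = prod_one fp S1 S2.
Proof.
apply: pair_ext; rewrite compA /prodm /prod_one.
- by rewrite !pr1_pair -compA pr1_pair amor_one.
- by rewrite !pr2_pair -compA pr2_pair amor_one.
Qed.

Definition prod_alghom (C : MonoidalCategory) (fp : FiniteProducts C)
    (R1 S1 R2 S2 : Algebra C) (f1 : AlgHom R1 S1) (f2 : AlgHom R2 S2) :
    AlgHom (prod_alg fp R1 R2) (prod_alg fp S1 S2) :=
  {| amor := prodm fp (amor f1) (amor f2)
       : hom (prod_alg fp R1 R2) (prod_alg fp S1 S2);
     amor_mul := prodm_amor_mul fp f1 f2;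
     amor_one := prodm_amor_one fp f1 f2 |}.

Definition coeq_tens (C : MonoidalCategory) (ce : Coequalizers C)
    (A : Algebra C) (M : RightModule A) (X : LeftModule A) : C :=
  coeq_ob ce (ract M ⊠ idm X) ((idm M ⊠ lact X) ∘ assoc M A X).

Definition coeq_tens_map (C : MonoidalCategory) (ce : Coequalizers C)
    (A : Algebra C) (M : RightModule A) (X : LeftModule A) :
    hom (M ⊗ X) (coeq_tens ce M X) :=
  coeq_map ce (ract M ⊠ idm X) ((idm M ⊠ lact X) ∘ assoc M A X).

Definition coeq_tensP (C : MonoidalCategory) (ce : Coequalizers C)
    (A : Algebra C) (M : RightModule A) (X : LeftModule A) :
    IsCoequalizer (ract M ⊠ idm X) ((idm M ⊠ lact X) ∘ assoc M A X)
      (coeq_tens_map ce M X) :=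
  coeqP ce _ _.

Definition restr_act (C : MonoidalCategory) (R S : Algebra C)
    (f : AlgHom R S) : hom (R ⊗ S) S :=
  mul S ∘ (amor f ⊠ idm S).

Lemma restr_actA (C : MonoidalCategory) (R S : Algebra C) (f : AlgHom R S) :
  restr_act f ∘ (mul R ⊠ idm S)
  = restr_act f ∘ (idm R ⊠ restr_act f) ∘ assoc R R S.
Proof.
rewrite /restr_act -!compA tens_idr amor_mul -tens_idr compA mulA.
rewrite -!compA assoc_nat; congr (_ ∘ _).
by rewrite !compA !tens_comp !comp_idl !comp_idr.
Qed.

Lemma restr_act1 (C : MonoidalCategory) (R S : Algebra C) (f : AlgHom R S) :
  restr_act f ∘ (one R ⊠ idm S) = lunit S.
Proof. by rewrite /restr_act -compA tens_idr amor_one mul1l. Qed.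

(* S as a left R-module, with action m_S (f ⊠ Id). *)
Definition restr (C : MonoidalCategory) (R S : Algebra C) (f : AlgHom R S) :
    LeftModule R :=
  {| lcar := alg S; lact := restr_act f;
     lactA := restr_actA f; lact1 := restr_act1 f |}.

Lemma restr_act_mul (C : MonoidalCategory) (R S : Algebra C)
    (f : AlgHom R S) :
  mul S ∘ (restr_act f ⊠ idm S)
  = restr_act f ∘ (idm R ⊠ mul S) ∘ assoc R S S.
Proof.
rewrite /restr_act -tens_idr compA mulA -!compA assoc_nat; congr (_ ∘ _).
by rewrite !compA !tens_comp !comp_idl !comp_idr tens_id comp_idr.
Qed.

Lemma ind_act_compat (C : MonoidalCategory) (ce : Coequalizers C)
    (R S : Algebra C) (f : AlgHom R S) (X : RightModule R) :
  let q := coeq_tens_map ce X (restr f) in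
  let t := q ∘ (idm X ⊠ mul S) ∘ assoc X S S in
  t ∘ ((ract X ⊠ idm S) ⊠ idm S)
  = t ∘ (((idm X ⊠ lact (restr f)) ∘ assoc X R S) ⊠ idm S).
Proof.
move=> q t.
have eq : q ∘ (ract X ⊠ idm S) = q ∘ (idm X ⊠ restr_act f) ∘ assoc X R S.
  exact: coeq_eq (coeq_tensP ce X (restr f)).
rewrite /t /= -tens_idr -!compA assoc_nat.
rewrite [assoc X S S ∘ _]compA assoc_nat -!compA tens_id.
rewrite [(idm X ⊠ mul S) ∘ (ract X ⊠ _) ∘ _]compA tens_swap -!compA.
rewrite [in LHS]compA eq -!compA.
congr (_ ∘ _); rewrite [in RHS]compA tens_idl restr_act_mul -!tens_idl.
rewrite -!compA pentagon; congr (_ ∘ _).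
by congr (_ ∘ _); rewrite -tens_id !compA assoc_nat.
Qed.

(* The right action of S on X ⊗_R S induced by m_S: the unique a with
   a (q ⊠ Id) = q (Id ⊠ m_S) assoc. *)
Definition ind_act (C : MonoidalCategory) (ce : Coequalizers C)
    (cf : forall X : C, Coflat X) (R S : Algebra C) (f : AlgHom R S)
    (X : RightModule R) :
    hom (coeq_tens ce X (restr f) ⊗ S) (coeq_tens ce X (restr f)) :=
  coeq_desc (coflat_r (cf S) (coeq_tensP ce X (restr f)))
    (ind_act_compat ce f X).

Lemma ind_actE (C : MonoidalCategory) (ce : Coequalizers C)
    (cf : forall X : C, Coflat X) (R S : Algebra C) (f : AlgHom R S)
    (X : RightModule R) :
  ind_act ce cf f X ∘ (coeq_tens_map ce X (restr f) ⊠ idm S)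
  = coeq_tens_map ce X (restr f) ∘ (idm X ⊠ mul S) ∘ assoc X S S.
Proof. exact: coeq_fac. Qed.

Lemma ind_actA (C : MonoidalCategory) (ce : Coequalizers C)
    (cf : forall X : C, Coflat X) (R S : Algebra C) (f : AlgHom R S)
    (X : RightModule R) :
  ind_act ce cf f X ∘ (ind_act ce cf f X ⊠ idm S)
  = ind_act ce cf f X ∘ (idm _ ⊠ mul S) ∘ assoc _ S S.
Proof.
apply: (coeq_uniq (coflat_r (cf S)
  (coflat_r (cf S) (coeq_tensP ce X (restr f))))).
rewrite -!compA tens_idr ind_actE -!tens_idr.
rewrite [in LHS]compA ind_actE assoc_nat tens_id.
rewrite [(idm _ ⊠ mul S) ∘ _ ∘ _]compA tens_swap.
rewrite -[in RHS]compA [in RHS]compA ind_actE -!compA; congr (_ ∘ _).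
rewrite [assoc X S S ∘ _ ∘ _]compA assoc_nat -[in LHS]compA.
rewrite [in LHS]compA tens_idl mulA -!tens_idl -!compA pentagon.
by congr (_ ∘ _); rewrite !compA -assoc_nat tens_id.
Qed.

Lemma ind_act1 (C : MonoidalCategory) (ce : Coequalizers C)
    (cf : forall X : C, Coflat X) (R S : Algebra C) (f : AlgHom R S)
    (X : RightModule R) :
  ind_act ce cf f X ∘ (idm _ ⊠ one S) = runit (coeq_tens ce X (restr f)).
Proof.
apply: (coeq_uniq (coflat_r (cf (munit C)) (coeq_tensP ce X (restr f)))).
rewrite -compA tens_swap compA ind_actE runit_nat -!compA; congr (_ ∘ _).
by rewrite -tens_id assoc_nat compA tens_idl mul1r runit_tens.
Qed.

Definition ind_ob (C : MonoidalCategory) (ce : Coequalizers C)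
    (cf : forall X : C, Coflat X) (R S : Algebra C) (f : AlgHom R S)
    (X : RMod R) : RMod S :=
  {| rcar := coeq_tens ce X (restr f); ract := ind_act ce cf f X;
     ractA := ind_actA ce cf f X; ract1 := ind_act1 ce cf f X |}.

Lemma coeq_tensm_compat (C : MonoidalCategory) (ce : Coequalizers C)
    (A : Algebra C) (M N : RightModule A) (h : RModHom M N)
    (X : LeftModule A) :
  let t := coeq_tens_map ce N X ∘ (rmor h ⊠ idm X) in
  t ∘ (ract M ⊠ idm X) = t ∘ (idm M ⊠ lact X) ∘ assoc M A X.
Proof.
move=> t; rewrite /t -!compA tens_idr rmor_act -tens_idr.
rewrite compA (coeq_eq (coeq_tensP ce N X)) -!compA; congr (_ ∘ _).
by rewrite assoc_nat tens_id !compA tens_swap.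
Qed.

(* h ⊗_A X: the unique morphism with (h ⊗_A X) q = q (h ⊠ Id). *)
Definition coeq_tensm (C : MonoidalCategory) (ce : Coequalizers C)
    (A : Algebra C) (M N : RightModule A) (h : RModHom M N)
    (X : LeftModule A) : hom (coeq_tens ce M X) (coeq_tens ce N X) :=
  coeq_desc (coeq_tensP ce M X) (coeq_tensm_compat ce h X).

Lemma coeq_tensmE (C : MonoidalCategory) (ce : Coequalizers C)
    (A : Algebra C) (M N : RightModule A) (h : RModHom M N)
    (X : LeftModule A) :
  coeq_tensm ce h X ∘ coeq_tens_map ce M X
  = coeq_tens_map ce N X ∘ (rmor h ⊠ idm X).
Proof. exact: coeq_fac. Qed.

Lemma ind_mor_act (C : MonoidalCategory) (ce : Coequalizers C)
    (cf : forall X : C, Coflat X) (R S : Algebra C) (f : AlgHom R S)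
    (X Y : RightModule R) (h : RModHom X Y) :
  coeq_tensm ce h (restr f) ∘ ind_act ce cf f X
  = ind_act ce cf f Y ∘ (coeq_tensm ce h (restr f) ⊠ idm S).
Proof.
apply: (coeq_uniq (coflat_r (cf S) (coeq_tensP ce X (restr f)))).
rewrite -!compA ind_actE tens_idr coeq_tensmE -tens_idr.
rewrite [in RHS]compA ind_actE [in LHS]compA coeq_tensmE -!compA.
by congr (_ ∘ _); rewrite assoc_nat tens_id !compA tens_swap.
Qed.

Definition ind_mor (C : MonoidalCategory) (ce : Coequalizers C)
    (cf : forall X : C, Coflat X) (R S : Algebra C) (f : AlgHom R S)
    (X Y : RMod R) (h : hom X Y) :
    hom (ind_ob ce cf f X) (ind_ob ce cf f Y) :=
  Build_RModHom (M := ind_ob ce cf f X) (N := ind_ob ce cf f Y)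
    (ind_mor_act ce cf f h).

Lemma ind_mor_id (C : MonoidalCategory) (ce : Coequalizers C)
    (cf : forall X : C, Coflat X) (R S : Algebra C) (f : AlgHom R S)
    (X : RMod R) :
  ind_mor ce cf f (idm X) = idm (ind_ob ce cf f X).
Proof.
apply: RModHom_eq; apply: (coeq_uniq (coeq_tensP ce X (restr f))).
apply: (eq_trans (coeq_tensmE ce (rmod_id X) (restr f))).
by rewrite tens_id comp_idr; symmetry; exact: comp_idl.
Qed.

Lemma ind_mor_comp (C : MonoidalCategory) (ce : Coequalizers C)
    (cf : forall X : C, Coflat X) (R S : Algebra C) (f : AlgHom R S)
    (X Y Z : RMod R) (k : hom Y Z) (h : hom X Y) :
  ind_mor ce cf f (k ∘ h) = ind_mor ce cf f k ∘ ind_mor ce cf f h.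
Proof.
apply: RModHom_eq; apply: (coeq_uniq (coeq_tensP ce X (restr f))).
apply: (eq_trans (coeq_tensmE ce (rmod_comp k h) (restr f))).
rewrite -[RHS]/((coeq_tensm ce k (restr f) ∘ coeq_tensm ce h (restr f))
  ∘ coeq_tens_map ce X (restr f)).
by rewrite -compA coeq_tensmE compA coeq_tensmE -compA tens_idr.
Qed.

Definition induction (C : MonoidalCategory) (ce : Coequalizers C)
    (cf : forall X : C, Coflat X) (R S : Algebra C) (f : AlgHom R S) :
    Functor (RMod R) (RMod S) :=
  {| fob := ind_ob ce cf f; fmap := @ind_mor C ce cf R S f;
     fmap_id := ind_mor_id ce cf f; fmap_comp := @ind_mor_comp C ce cf R S f |}.

(* Main.v *)
(** For an algebra morphism [f : R -> S], the functor [f^*] is semiseparable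
    (resp. separable, naturally full) exactly when there is a morphism of
    [R]-bimodules [chi : S -> R] with [f chi f = f] (resp. [chi f = id],
    [f chi = id]).  Given [chi], retract a morphism [g] of induced modules to
    [nu g eta], where [eta] is the unit of the adjunction between induction and
    restriction and [nu : Y ⊗_R S -> Y] sends [y ⊗ s] to [y chi(s)].  Conversely,
    apply the retraction [P] to [S ⊗_R S -> S = R ⊗_R S] to get [chi : S -> R];
    naturality of [P] makes [chi] commute with left multiplication by every
    [r : 1 -> R], hence left [R]-linear because [1] is a left ⊗-generator.
    These conditions are preserved by [chi1 × chi2]. *)

From Corelib Require Import ssreflect.
Require Import Defs.

Set Implicit Arguments.
Unset Strict Implicit.
Unset Printing Implicit Defensive.

(** * Rewriting under composition and unit coherence *)

(** Since [∘] associates to the right, [g ∘ f] is not a subterm of [g ∘ f ∘ k]; quantifying over the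
    tail [k] makes an equation on [g ∘ f] usable there. *)
Lemma comp_pre (C : Category) (X Y Z : C) (g : hom Y Z) (f : hom X Y)
    (h : hom X Z) :
  g ∘ f = h -> forall (W : C) (k : hom W X), g ∘ f ∘ k = h ∘ k.
Proof. by move=> e W k; rewrite compA e. Qed.

Lemma comp_pre2 (C : Category) (X Y Y' Z : C) (g : hom Y Z) (f : hom X Y)
    (g' : hom Y' Z) (f' : hom X Y') :
  g ∘ f = g' ∘ f' -> forall (W : C) (k : hom W X), g ∘ f ∘ k = g' ∘ f' ∘ k.
Proof. by move=> e W k; rewrite !compA e. Qed.

(** Kelly's argument: tensoring with the unit object is faithful and associators are invertible, so
    one may tensor on the left with the unit object and precompose with two associators; what is
    left follows from the pentagon, the triangle and naturality. *)
Lemma lunit_tens (C : MonoidalCategory) (A B : C) :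
  lunit (A ⊗ B) ∘ assoc (munit C) A B = lunit A ⊠ idm B.
Proof.
have faithful (X Y : C) (f g : hom X Y) :
    idm (munit C) ⊠ f = idm (munit C) ⊠ g -> f = g.
  move=> e; rewrite -(comp_idr f) -(comp_idr g) -lunit_invK !compA.
  by rewrite -!lunit_nat e.
apply: faithful.
have cancel (X : C) (f g : hom (munit C ⊗ (munit C ⊗ A) ⊗ B) X) :
    f ∘ assoc _ _ B ∘ (assoc _ _ A ⊠ idm B)
    = g ∘ assoc _ _ B ∘ (assoc _ _ A ⊠ idm B) -> f = g.
  move=> e; rewrite -(comp_idr f) -(comp_idr g) -assoc_invK.
  rewrite -(comp_idr (assoc _ _ B)) -tens_id -assoc_invK -tens_idr.
  by rewrite !compA -(compA f) -(compA g) e.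
apply: cancel.
rewrite -tens_idl -compA pentagon compA triangle -tens_id -assoc_nat.
by rewrite -triangle -tens_idr compA assoc_nat compA.
Qed.


Lemma lunit_inv_tens (C : MonoidalCategory) (A B : C) :
  assoc (munit C) A B ∘ (lunit_inv A ⊠ idm B) = lunit_inv (A ⊗ B).
Proof.
rewrite -(comp_idl (assoc _ _ _ ∘ _)) -lunitK -compA (comp_pre (lunit_tens A B)).
by rewrite tens_idr lunit_invK tens_id comp_idr.
Qed.

Lemma lunit_inv_nat (C : MonoidalCategory) (A B : C) (f : hom A B) :
  (idm (munit C) ⊠ f) ∘ lunit_inv A = lunit_inv B ∘ f.
Proof.
rewrite -(comp_idl ((_ ⊠ _) ∘ _)) -lunitK -compA (comp_pre2 (lunit_nat f)).
by rewrite lunit_invK comp_idr.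
Qed.

Lemma runit_inv_nat (C : MonoidalCategory) (A B : C) (f : hom A B) :
  (f ⊠ idm (munit C)) ∘ runit_inv A = runit_inv B ∘ f.
Proof.
rewrite -(comp_idl ((_ ⊠ _) ∘ _)) -runitK -compA (comp_pre2 (runit_nat f)).
by rewrite runit_invK comp_idr.
Qed.

Lemma runit_inv_tens (C : MonoidalCategory) (A B : C) :
  idm A ⊠ runit_inv B = assoc A B (munit C) ∘ runit_inv (A ⊗ B).
Proof.
rewrite -(comp_idr (idm A ⊠ _)) -(runit_invK (A ⊗ B)) -runit_tens.
by rewrite -!compA (comp_pre (tens_idl _ _ _)) runitK tens_id comp_idl.
Qed.

Lemma lunit_triangle (C : MonoidalCategory) (A B : C) :
  (idm A ⊠ lunit B) ∘ assoc A (munit C) B ∘ (runit_inv A ⊠ idm B)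
  = idm (A ⊗ B).
Proof. by rewrite (comp_pre (triangle A B)) tens_idr runit_invK tens_id. Qed.

(** * Restriction of scalars and its adjunction with induction *)

Definition reg (C : MonoidalCategory) (A : Algebra C) : RightModule A :=
  {| rcar := alg A; ract := mul A; ractA := mulA A; ract1 := mul1r A |}.

Lemma pull_actA (C : MonoidalCategory) (R S : Algebra C) (f : AlgHom R S)
    (N : RightModule S) :
  (ract N ∘ (idm N ⊠ f)) ∘ ((ract N ∘ (idm N ⊠ f)) ⊠ idm R)
  = (ract N ∘ (idm N ⊠ f)) ∘ (idm N ⊠ mul R) ∘ assoc N R R.
Proof.
rewrite -tens_idr -!compA (comp_pre (tens_swap _ _)) -!compA (comp_pre (ractA N)).
rewrite -!compA; congr (_ ∘ _); rewrite (comp_pre (tens_idl _ _ _)) amor_mul.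
by rewrite -tens_idl -!compA -assoc_nat !tens_comp !comp_idl !comp_idr.
Qed.

Lemma pull_act1 (C : MonoidalCategory) (R S : Algebra C) (f : AlgHom R S)
    (N : RightModule S) :
  (ract N ∘ (idm N ⊠ f)) ∘ (idm N ⊠ one R) = runit N.
Proof. by rewrite -compA tens_idl amor_one ract1. Qed.

(** Restriction of scalars along [f], the right adjoint of induction. *)
Definition pull (C : MonoidalCategory) (R S : Algebra C) (f : AlgHom R S)
    (N : RightModule S) : RightModule R :=
  {| rcar := rcar N; ract := ract N ∘ (idm N ⊠ f);
     ractA := pull_actA f N; ract1 := pull_act1 f N |}.

Lemma restr_coeq_eq (C : MonoidalCategory) (ce : Coequalizers C)
    (R S : Algebra C) (f : AlgHom R S) (X : RightModule R) :
  coeq_tens_map ce X (restr f) ∘ (ract X ⊠ idm S)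
  = coeq_tens_map ce X (restr f) ∘ (idm X ⊠ restr_act f) ∘ assoc X R S.
Proof. exact: coeq_eq (coeq_tensP ce X (restr f)). Qed.

Lemma ind_mor_eq (C : MonoidalCategory) (ce : Coequalizers C)
    (cf : forall X : C, Coflat X) (R S : Algebra C) (f : AlgHom R S)
    (X Y : RMod R) (h : hom X Y) (g : hom (ind_ob ce cf f X) (ind_ob ce cf f Y)) :
  coeq_tens_map ce Y (restr f) ∘ (rmor h ⊠ idm S)
    = rmor g ∘ coeq_tens_map ce X (restr f) ->
  ind_mor ce cf f h = g.
Proof.
move=> e; apply: RModHom_eq; apply: (coeq_uniq (coeq_tensP ce X (restr f))).
by rewrite -e; exact: coeq_tensmE.
Qed.

Lemma counit_compat (C : MonoidalCategory) (R S : Algebra C)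
    (f : AlgHom R S) (N : RightModule S) :
  ract N ∘ (ract (pull f N) ⊠ idm S)
  = ract N ∘ (idm N ⊠ lact (restr f)) ∘ assoc N R S.
Proof.
rewrite /= /restr_act -tens_idr -tens_idl (comp_pre (ractA N)) -!compA.
by rewrite assoc_nat.
Qed.

(** The action of [N] descended to [N ⊗_R S]; for [N = reg S] it is the multiplication
    [S ⊗_R S -> S]. *)
Definition counit_mor (C : MonoidalCategory) (ce : Coequalizers C)
    (R S : Algebra C) (f : AlgHom R S) (N : RightModule S) :
    hom (coeq_tens ce (pull f N) (restr f)) N :=
  coeq_desc (coeq_tensP ce (pull f N) (restr f)) (counit_compat f N).

Lemma counit_morE (C : MonoidalCategory) (ce : Coequalizers C)
    (R S : Algebra C) (f : AlgHom R S) (N : RightModule S) :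
  counit_mor ce f N ∘ coeq_tens_map ce (pull f N) (restr f) = ract N.
Proof. exact: coeq_fac. Qed.

(** By coflatness of [S] the coequalizer map stays epi after tensoring with [S]; precomposed with
    it, the claim is associativity of the action of [N]. *)
Lemma counit_act (C : MonoidalCategory) (ce : Coequalizers C)
    (cf : forall X : C, Coflat X) (R S : Algebra C) (f : AlgHom R S)
    (N : RightModule S) :
  counit_mor ce f N ∘ ind_act ce cf f (pull f N)
  = ract N ∘ (counit_mor ce f N ⊠ idm S).
Proof.
apply: (coeq_uniq (coflat_r (cf S) (coeq_tensP ce (pull f N) (restr f)))).
rewrite -!compA ind_actE tens_idr counit_morE. rewrite (comp_pre (counit_morE ce f N)).
by symmetry; exact: (ractA N).
Qed.

Definition counit (C : MonoidalCategory) (ce : Coequalizers C)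
    (cf : forall X : C, Coflat X) (R S : Algebra C) (f : AlgHom R S)
    (N : RightModule S) : RModHom (ind_ob ce cf f (pull f N)) N :=
  Build_RModHom (M := ind_ob ce cf f (pull f N)) (counit_act ce cf f N).

Definition unit_mor (C : MonoidalCategory) (ce : Coequalizers C)
    (R S : Algebra C) (f : AlgHom R S) (X : RightModule R) :
    hom X (coeq_tens ce X (restr f)) :=
  coeq_tens_map ce X (restr f) ∘ (idm X ⊠ one S) ∘ runit_inv X.

(** In elements, [(x ⊗ 1) s = x ⊗ s]. Hence an [S]-linear map out of [X ⊗_R S] is determined by its
    composite with the unit. *)
Lemma ind_act_unit (C : MonoidalCategory) (ce : Coequalizers C)
    (cf : forall X : C, Coflat X) (R S : Algebra C) (f : AlgHom R S)
    (X : RightModule R) :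
  ind_act ce cf f X ∘ (unit_mor ce f X ⊠ idm S) = coeq_tens_map ce X (restr f).
Proof.
rewrite /unit_mor -!tens_idr (comp_pre (ind_actE ce cf f X)) -!compA.
rewrite (comp_pre (assoc_nat _ _ _)) -!compA (comp_pre (tens_idl _ _ _)) mul1l.
by rewrite lunit_triangle comp_idr.
Qed.

(** Balancedness over [R]: [x r ⊗ 1 = x ⊗ f(r) = (x ⊗ 1) f(r)]. *)
Lemma unit_act (C : MonoidalCategory) (ce : Coequalizers C)
    (cf : forall X : C, Coflat X) (R S : Algebra C) (f : AlgHom R S)
    (X : RightModule R) :
  unit_mor ce f X ∘ ract X
  = ract (pull f (ind_ob ce cf f X)) ∘ (unit_mor ce f X ⊠ idm R).
Proof.
rewrite /= -compA tens_swap compA ind_act_unit.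
rewrite /unit_mor -!compA -runit_inv_nat (comp_pre (tens_swap _ _)) -!compA.
rewrite (comp_pre (restr_coeq_eq _ _ _)) -!compA -tens_id.
rewrite (comp_pre (assoc_nat _ _ _)) -!compA -runit_inv_tens !tens_idl.
congr (_ ∘ (_ ⊠ _)).
by rewrite /restr_act -!compA -(comp_pre2 (tens_swap f _)) (comp_pre (mul1r _))
  (comp_pre (runit_nat _)) -!compA runit_invK comp_idr.
Qed.

Definition unit (C : MonoidalCategory) (ce : Coequalizers C)
    (cf : forall X : C, Coflat X) (R S : Algebra C) (f : AlgHom R S)
    (X : RightModule R) : RModHom X (pull f (ind_ob ce cf f X)) :=
  Build_RModHom (N := pull f (ind_ob ce cf f X)) (unit_act ce cf f X).

Lemma unit_nat (C : MonoidalCategory) (ce : Coequalizers C)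
    (R S : Algebra C) (f : AlgHom R S) (X Y : RightModule R) (h : RModHom X Y) :
  coeq_tensm ce h (restr f) ∘ unit_mor ce f X = unit_mor ce f Y ∘ rmor h.
Proof.
rewrite /unit_mor (comp_pre (coeq_tensmE ce h (restr f))) -!compA.
by rewrite -(comp_pre2 (tens_swap _ _)) runit_inv_nat.
Qed.

(** * Bimodule morphisms and the retraction they induce *)

(** Here [S] is an [R]-bimodule through [f] on both sides. The second field is bracketed as right
    [R]-linearity from [pull f (reg S)] to [reg R]. *)
Record bimodule_map (C : MonoidalCategory) (R S : Algebra C)
    (f : AlgHom R S) (chi : hom S R) : Prop := {
  bimod_l : chi ∘ restr_act f = mul R ∘ (idm R ⊠ chi);
  bimod_r : chi ∘ mul S ∘ (idm S ⊠ f) = mul R ∘ (chi ⊠ idm R)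
}.

(** Left linearity of [chi] is what makes [y ⊗ s ↦ y chi(s)] balanced:
    [(y r) chi(s) = y chi(f(r) s)]. *)
Lemma retract_compat (C : MonoidalCategory) (R S : Algebra C)
    (f : AlgHom R S) (chi : hom S R) (b : bimodule_map f chi)
    (Y : RightModule R) :
  ract Y ∘ (idm Y ⊠ chi) ∘ (ract Y ⊠ idm S)
  = (ract Y ∘ (idm Y ⊠ chi)) ∘ (idm Y ⊠ lact (restr f)) ∘ assoc Y R S.
Proof.
rewrite tens_swap -!compA (comp_pre (ractA Y)) (comp_pre (tens_idl _ _ _)) /=.
rewrite (bimod_l b) -tens_idl -!compA -assoc_nat.
by rewrite tens_id.
Qed.

Definition retract_mor (C : MonoidalCategory) (ce : Coequalizers C)
    (R S : Algebra C) (f : AlgHom R S) (chi : hom S R)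
    (b : bimodule_map f chi) (Y : RightModule R) :
    hom (coeq_tens ce Y (restr f)) Y :=
  coeq_desc (coeq_tensP ce Y (restr f))
    (eq_trans (eq_sym (compA _ _ _)) (retract_compat b Y)).

Lemma retract_morE (C : MonoidalCategory) (ce : Coequalizers C)
    (R S : Algebra C) (f : AlgHom R S) (chi : hom S R)
    (b : bimodule_map f chi) (Y : RightModule R) :
  retract_mor ce b Y ∘ coeq_tens_map ce Y (restr f) = ract Y ∘ (idm Y ⊠ chi).
Proof. exact: coeq_fac. Qed.

Lemma retract_nat (C : MonoidalCategory) (ce : Coequalizers C)
    (R S : Algebra C) (f : AlgHom R S) (chi : hom S R)
    (b : bimodule_map f chi) (X Y : RightModule R) (h : RModHom X Y) :
  rmor h ∘ retract_mor ce b X = retract_mor ce b Y ∘ coeq_tensm ce h (restr f).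
Proof.
apply: (coeq_uniq (coeq_tensP ce X (restr f))).
rewrite -!compA retract_morE coeq_tensmE (comp_pre (retract_morE ce b Y)).
by rewrite (comp_pre (rmor_act h)) -!compA tens_swap.
Qed.

(** Right linearity of [chi] enters here: [y chi(s f(r)) = (y chi(s)) r]. *)
Lemma retract_act (C : MonoidalCategory) (ce : Coequalizers C)
    (cf : forall X : C, Coflat X) (R S : Algebra C) (f : AlgHom R S)
    (chi : hom S R) (b : bimodule_map f chi) (Y : RightModule R) :
  retract_mor ce b Y ∘ ract (pull f (ind_ob ce cf f Y))
  = ract Y ∘ (retract_mor ce b Y ⊠ idm R).
Proof.
apply: (coeq_uniq (coflat_r (cf R) (coeq_tensP ce Y (restr f)))).
rewrite /= -!compA tens_idr retract_morE tens_swap.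
rewrite (comp_pre (ind_actE ce cf f Y)) -!compA (comp_pre (retract_morE ce b Y)).
rewrite -!compA -tens_id (assoc_nat (idm Y) (idm S) f) !(comp_pre (tens_idl _ _ _)).
rewrite -compA (bimod_r b) -tens_idl -!compA -assoc_nat -tens_idr.
by rewrite (comp_pre (ractA Y)) -!compA.
Qed.

Lemma retract_unit (C : MonoidalCategory) (ce : Coequalizers C)
    (R S : Algebra C) (f : AlgHom R S) (chi : hom S R)
    (b : bimodule_map f chi) (Y : RightModule R) :
  chi ∘ one S = one R -> retract_mor ce b Y ∘ unit_mor ce f Y = idm Y.
Proof.
move=> chi1; rewrite /unit_mor (comp_pre (retract_morE ce b Y)) -!compA.
by rewrite (comp_pre (tens_idl _ _ _)) chi1 (comp_pre (ract1 _)) runit_invK.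
Qed.

Definition retract (C : MonoidalCategory) (ce : Coequalizers C)
    (cf : forall X : C, Coflat X) (R S : Algebra C) (f : AlgHom R S)
    (chi : hom S R) (b : bimodule_map f chi) (Y : RightModule R) :
    RModHom (pull f (ind_ob ce cf f Y)) Y :=
  Build_RModHom (M := pull f (ind_ob ce cf f Y)) (retract_act ce cf b Y).

Definition pull_hom (C : MonoidalCategory) (R S : Algebra C) (f : AlgHom R S)
    (M N : RightModule S) (h : RModHom M N) : RModHom (pull f M) (pull f N).
Proof.
refine (Build_RModHom (M := pull f M) (N := pull f N) (rmor := rmor h) _).
abstract by rewrite /= (comp_pre (rmor_act h)) -!compA tens_swap.
Defined.

(** * From bimodule morphisms to properties of the induction functor *)

Definition bimod_retrofamily (C : MonoidalCategory) (ce : Coequalizers C)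
    (cf : forall X : C, Coflat X) (R S : Algebra C) (f : AlgHom R S)
    (chi : hom S R) (b : bimodule_map f chi) :
    hom_retrofamily (induction ce cf f) :=
  fun X Y g =>
    rmod_comp (retract ce cf b Y) (rmod_comp (pull_hom f g) (unit ce cf f X)).

Lemma bimod_retrofamily_natural (C : MonoidalCategory) (ce : Coequalizers C)
    (cf : forall X : C, Coflat X) (R S : Algebra C) (f : AlgHom R S)
    (chi : hom S R) (b : bimodule_map f chi) :
  is_natural (@bimod_retrofamily C ce cf R S f chi b).
Proof.
move=> X X' Y Y' h k g; apply: RModHom_eq => /=.
by rewrite -!compA unit_nat -(comp_pre2 (retract_nat ce b k)) /unit_mor -!compA.
Qed.

(** A scalar [u(z)] moves across the tensor product over [R]. It is applied with [u = chi ∘ one S]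
    and with [u = chi]. *)
Lemma coeq_tens_map_act (C : MonoidalCategory) (ce : Coequalizers C)
    (R S : Algebra C) (f : AlgHom R S) (Y : RightModule R) (Z : C)
    (u : hom Z R) :
  coeq_tens_map ce Y (restr f) ∘ ((ract Y ∘ (idm Y ⊠ u)) ⊠ idm S)
  = coeq_tens_map ce Y (restr f)
      ∘ (idm Y ⊠ (mul S ∘ ((f ∘ u) ⊠ idm S))) ∘ assoc Y Z S.
Proof.
rewrite -tens_idr (comp_pre (restr_coeq_eq ce f Y)) -!compA assoc_nat.
by rewrite (comp_pre (tens_idl _ _ _)) /restr_act -compA tens_idr.
Qed.

(** The composite [nu eta] is [y ↦ y chi(1)], and [f chi(1) = f chi f(1) = 1], so
    [y chi(1) ⊗ s = y ⊗ s]: induction sends [nu eta] to the identity even when [chi(1)] differs from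
    [1]. *)
Lemma retract_unit_coeq (C : MonoidalCategory) (ce : Coequalizers C)
    (R S : Algebra C) (f : AlgHom R S) (chi : hom S R)
    (b : bimodule_map f chi) (Y : RightModule R) :
  f ∘ chi ∘ f = f ->
  coeq_tens_map ce Y (restr f) ∘ ((retract_mor ce b Y ∘ unit_mor ce f Y) ⊠ idm S)
  = coeq_tens_map ce Y (restr f).
Proof.
move=> fcf; have fc1 : f ∘ chi ∘ one S = one S.
  by rewrite -(amor_one f) !compA -(compA (amor f)) fcf.
rewrite /unit_mor (comp_pre (retract_morE ce b Y)) -!compA.
rewrite (comp_pre (tens_idl _ _ _)) compA -tens_idr.
rewrite (comp_pre (coeq_tens_map_act ce f Y _)) fc1 mul1l.
by rewrite -!compA lunit_triangle comp_idr.
Qed.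

(** Moving the scalar across, [y chi(s) ⊗ t = y ⊗ f(chi(s)) t = y ⊗ s t]. *)
Lemma coeq_tens_map_retract (C : MonoidalCategory) (ce : Coequalizers C)
    (cf : forall X : C, Coflat X) (R S : Algebra C) (f : AlgHom R S)
    (chi : hom S R) (b : bimodule_map f chi) (Y : RightModule R) :
  f ∘ chi = idm S ->
  coeq_tens_map ce Y (restr f) ∘ (retract_mor ce b Y ⊠ idm S)
  = ind_act ce cf f Y.
Proof.
move=> fc; apply: (coeq_uniq (coflat_r (cf S) (coeq_tensP ce Y (restr f)))).
rewrite ind_actE -compA tens_idr retract_morE coeq_tens_map_act fc tens_id.
by rewrite comp_idr.
Qed.

Lemma bimod_semiseparable (C : MonoidalCategory) (ce : Coequalizers C)
    (cf : forall X : C, Coflat X) (R S : Algebra C) (f : AlgHom R S)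
    (chi : hom S R) :
  bimodule_map f chi -> f ∘ chi ∘ f = f -> semiseparable (induction ce cf f).
Proof.
move=> b fcf; exists (@bimod_retrofamily C ce cf R S f chi b).
split; first exact: bimod_retrofamily_natural.
move=> X Y h; apply: ind_mor_eq.
apply: eq_trans (eq_sym (coeq_tensmE ce h (restr f))).
(* Naturality of the unit turns the retraction of the induced [h] into [nu eta h], and [nu eta]
   disappears under induction. *)
rewrite /= unit_nat compA -tens_idr.
by rewrite (comp_pre (retract_unit_coeq ce b Y fcf)).
Qed.

Lemma bimod_separable (C : MonoidalCategory) (ce : Coequalizers C)
    (cf : forall X : C, Coflat X) (R S : Algebra C) (f : AlgHom R S)
    (chi : hom S R) :
  bimodule_map f chi -> chi ∘ f = idm R -> separable (induction ce cf f).
Proof.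
move=> b cfid; exists (@bimod_retrofamily C ce cf R S f chi b).
split; first exact: bimod_retrofamily_natural.
move=> X Y h; apply: RModHom_eq; rewrite /= unit_nat compA retract_unit.
  by rewrite -(amor_one f) compA cfid comp_idl.
by rewrite comp_idl.
Qed.

Lemma bimod_naturally_full (C : MonoidalCategory) (ce : Coequalizers C)
    (cf : forall X : C, Coflat X) (R S : Algebra C) (f : AlgHom R S)
    (chi : hom S R) :
  bimodule_map f chi -> f ∘ chi = idm S -> naturally_full (induction ce cf f).
Proof.
move=> b fc; exists (@bimod_retrofamily C ce cf R S f chi b).
split; first exact: bimod_retrofamily_natural.
move=> X Y g; apply: ind_mor_eq.
(* Inducing [nu] gives the action on [Y ⊗_R S]; linearity of [g] then moves the action past [g],
   where it meets the unit and leaves the coequalizer map. *)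
rewrite /= -2!tens_idr (comp_pre (coeq_tens_map_retract ce cf b Y fc)).
have gact := rmor_act (M := ind_ob ce cf f X) (N := ind_ob ce cf f Y) g.
by rewrite -(comp_pre2 gact) /= ind_act_unit.
Qed.

(** * Left multiplications and the identification of [S] with [R ⊗_R S] *)

(** Evaluation at the unit of [A] recovers [u] from [u(x) a]. *)
Lemma mul_inj (C : MonoidalCategory) (A : Algebra C) (X : C) (u v : hom X A) :
  mul A ∘ (u ⊠ idm A) = mul A ∘ (v ⊠ idm A) -> u = v.
Proof.
have mul_one (w : hom X A) :
    mul A ∘ (w ⊠ idm A) ∘ (idm X ⊠ one A) ∘ runit_inv X = w.
  rewrite -(comp_pre2 (tens_swap _ _)) (comp_pre (mul1r A)).
  by rewrite (comp_pre (runit_nat _)) -compA runit_invK comp_idr.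
by move=> e; rewrite -(mul_one u) -(mul_one v) (comp_pre2 e).
Qed.

Lemma lmul_act (C : MonoidalCategory) (A : Algebra C) (r : hom (munit C) A) :
  (mul A ∘ (r ⊠ idm A) ∘ lunit_inv A) ∘ mul A
  = mul A ∘ ((mul A ∘ (r ⊠ idm A) ∘ lunit_inv A) ⊠ idm A).
Proof.
rewrite -!tens_idr (comp_pre (mulA A)) -!compA -lunit_inv_nat.
rewrite (comp_pre (assoc_nat _ _ _)) -!compA lunit_inv_tens tens_id.
by rewrite (comp_pre2 (tens_swap _ _)).
Qed.

Definition lmul (C : MonoidalCategory) (A : Algebra C) (r : hom (munit C) A) :
    RModHom (reg A) (reg A) :=
  Build_RModHom (M := reg A) (N := reg A) (lmul_act r).

Definition alghom_rmod (C : MonoidalCategory) (R S : Algebra C)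
    (f : AlgHom R S) : RModHom (reg R) (pull f (reg S)).
Proof.
refine (Build_RModHom (M := reg R) (N := pull f (reg S)) (rmor := amor f) _).
abstract by rewrite /= amor_mul -compA tens_comp comp_idl comp_idr.
Defined.

(** The isomorphism [s ↦ 1 ⊗ s], whose inverse is induced by [restr_act f]. *)
Definition ind_reg_mor (C : MonoidalCategory) (ce : Coequalizers C)
    (R S : Algebra C) (f : AlgHom R S) :
    hom S (coeq_tens ce (reg R) (restr f)) :=
  coeq_tens_map ce (reg R) (restr f) ∘ (one R ⊠ idm S) ∘ lunit_inv S.

Lemma ind_reg_act (C : MonoidalCategory) (ce : Coequalizers C)
    (cf : forall X : C, Coflat X) (R S : Algebra C) (f : AlgHom R S) :
  ind_reg_mor ce f ∘ mul S
  = ind_act ce cf f (reg R) ∘ (ind_reg_mor ce f ⊠ idm S).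
Proof.
rewrite /ind_reg_mor -!tens_idr (comp_pre (ind_actE ce cf f (reg R))) -!compA.
rewrite (comp_pre (assoc_nat _ _ _)) -!compA lunit_inv_tens tens_id.
by rewrite (comp_pre2 (tens_swap _ _)) lunit_inv_nat.
Qed.

Definition ind_reg (C : MonoidalCategory) (ce : Coequalizers C)
    (cf : forall X : C, Coflat X) (R S : Algebra C) (f : AlgHom R S) :
    RModHom (reg S) (ind_ob ce cf f (reg R)) :=
  Build_RModHom (M := reg S) (N := ind_ob ce cf f (reg R)) (ind_reg_act ce cf f).

(** Balancedness again: [1 ⊗ f(r) s = r ⊗ s]. *)
Lemma ind_reg_restr_act (C : MonoidalCategory) (ce : Coequalizers C)
    (R S : Algebra C) (f : AlgHom R S) :
  ind_reg_mor ce f ∘ restr_act f = coeq_tens_map ce (reg R) (restr f).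
Proof.
rewrite /ind_reg_mor -!compA -lunit_inv_nat -(comp_pre2 (tens_swap _ _)).
rewrite -lunit_inv_tens -tens_id -(comp_pre2 (assoc_nat _ _ _)).
have := comp_pre (restr_coeq_eq ce f (reg R))
  (((one R ⊠ idm R) ⊠ idm S) ∘ (lunit_inv R ⊠ idm S)).
rewrite -!compA => <-; rewrite !tens_idr /= (comp_pre (mul1l R)) lunit_invK.
by rewrite tens_id comp_idr.
Qed.

Lemma restr_act_ind_reg (C : MonoidalCategory) (R S : Algebra C)
    (f : AlgHom R S) :
  restr_act f ∘ (one R ⊠ idm S) ∘ lunit_inv S = idm S.
Proof. by rewrite (comp_pre (restr_act1 f)) lunit_invK. Qed.

(** The [chi] extracted from a retraction [P]. *)
Definition reg_retract (C : MonoidalCategory) (ce : Coequalizers C)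
    (cf : forall X : C, Coflat X) (R S : Algebra C) (f : AlgHom R S)
    (P : hom_retrofamily (induction ce cf f)) :
    RModHom (pull f (reg S)) (reg R) :=
  P (pull f (reg S)) (reg R)
    (rmod_comp (ind_reg ce cf f) (counit ce cf f (reg S))).

Lemma counit_nat (C : MonoidalCategory) (ce : Coequalizers C)
    (R S : Algebra C) (f : AlgHom R S) (M N : RightModule S) (h : RModHom M N) :
  counit_mor ce f N ∘ coeq_tensm ce (pull_hom f h) (restr f)
  = rmor h ∘ counit_mor ce f M.
Proof.
apply: (coeq_uniq (coeq_tensP ce (pull f M) (restr f))).
rewrite -!compA coeq_tensmE (comp_pre (counit_morE ce f N)) counit_morE.
by symmetry; exact: (rmor_act h).
Qed.

Lemma counit_ind_mor (C : MonoidalCategory) (ce : Coequalizers C)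
    (R S : Algebra C) (f : AlgHom R S) (X : RightModule R) (N : RightModule S)
    (h : RModHom X (pull f N)) :
  counit_mor ce f N ∘ coeq_tensm ce h (restr f) ∘ coeq_tens_map ce X (restr f)
  = ract N ∘ (rmor h ⊠ idm S).
Proof. by rewrite coeq_tensmE (comp_pre (counit_morE ce f N)). Qed.

Lemma lmul_alghom (C : MonoidalCategory) (R S : Algebra C) (f : AlgHom R S)
    (r : hom (munit C) R) :
  rmor (lmul (f ∘ r)) ∘ f = f ∘ rmor (lmul r).
Proof.
rewrite /= -!compA -lunit_inv_nat (comp_pre (amor_mul f)) -!compA.
by rewrite !(comp_pre (tens_comp _ _ _ _)) !comp_idr comp_idl.
Qed.

Lemma lmul_restr_act (C : MonoidalCategory) (R S : Algebra C) (f : AlgHom R S)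
    (r : hom (munit C) R) :
  rmor (lmul (f ∘ r)) ∘ restr_act f = restr_act f ∘ (rmor (lmul r) ⊠ idm S).
Proof.
rewrite /restr_act compA (rmor_act (lmul (f ∘ r))) -!compA !tens_idr.
by rewrite lmul_alghom.
Qed.

(** Under the identification of [S] with [R ⊗_R S], inducing left multiplication by [r] gives left
    multiplication by [f(r)]. Equality is tested after [restr_act f], a split epimorphism with
    section [s ↦ 1 ⊗ s]. *)
Lemma lmul_ind_reg (C : MonoidalCategory) (ce : Coequalizers C)
    (R S : Algebra C) (f : AlgHom R S) (r : hom (munit C) R) :
  coeq_tensm ce (lmul r) (restr f) ∘ ind_reg_mor ce f
  = ind_reg_mor ce f ∘ rmor (lmul (f ∘ r)).
Proof.
have epi (Z : C) (u v : hom S Z) : u ∘ restr_act f = v ∘ restr_act f -> u = v.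
  move=> e; rewrite -(comp_idr u) -(comp_idr v) -(restr_act_ind_reg f).
  by rewrite !(comp_pre2 e).
apply: epi; rewrite -(compA (coeq_tensm _ _ _)) -(compA (ind_reg_mor ce f)).
rewrite lmul_restr_act ind_reg_restr_act.
apply: (eq_trans (coeq_tensmE ce (lmul r) (restr f))).
by rewrite (comp_pre (ind_reg_restr_act ce f)).
Qed.

(** * From properties of the induction functor to bimodule morphisms *)

Lemma reg_retract_bimod (C : MonoidalCategory) (ce : Coequalizers C)
    (cf : forall X : C, Coflat X) (R S : Algebra C) (f : AlgHom R S)
    (P : hom_retrofamily (induction ce cf f)) :
  left_tensor_generator (munit C) -> is_natural P ->
  bimodule_map f (rmor (reg_retract P)).
Proof.
move=> gen Pnat; split; last exact: (rmor_act (reg_retract P)).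
(* Right linearity came with [chi] being a morphism of right modules; the generator hypothesis
   reduces left linearity to elements [r : 1 -> R]. *)
apply: gen => r.
set chi := rmor (reg_retract P).
have chi_lmul : rmor (lmul r) ∘ chi = chi ∘ rmor (lmul (f ∘ r)).
  pose e := rmod_comp (ind_reg ce cf f) (counit ce cf f (reg S)).
  have lmul_e : rmod_comp (ind_mor ce cf f (lmul r)) e
      = rmod_comp e (ind_mor ce cf f (pull_hom f (lmul (f ∘ r)))).
    apply: RModHom_eq.
    change (coeq_tensm ce (lmul r) (restr f)
        ∘ ind_reg_mor ce f ∘ counit_mor ce f (reg S)
      = (ind_reg_mor ce f ∘ counit_mor ce f (reg S))
        ∘ coeq_tensm ce (pull_hom f (lmul (f ∘ r))) (restr f)).
    rewrite (comp_pre (lmul_ind_reg ce f r)).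
    rewrite -(compA (ind_reg_mor ce f) (counit_mor ce f (reg S))) counit_nat.
    by symmetry; exact: compA.
  (* Naturality of [P] in the target and in the source evaluates [P] on the two sides of [lmul_e],
     giving [r chi(s)] and [chi(f(r) s)] respectively. *)
  have e1 := Pnat (pull f (reg S)) (pull f (reg S)) (reg R) (reg R)
    (idm (c := RMod R) (pull f (reg S))) (lmul r) e.
  have e2 := Pnat (pull f (reg S)) (pull f (reg S)) (reg R) (reg R)
    (pull_hom f (lmul (f ∘ r))) (idm (c := RMod R) (reg R)) e.
  rewrite fmap_id !comp_idr in e1; rewrite fmap_id !comp_idl in e2.
  have := eq_trans (eq_trans (eq_sym e1) (f_equal _ lmul_e)) e2.
  by move/(f_equal (@rmor _ _ _ _)).
have lmulE (A : Algebra C) (s : hom (munit C) A) :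
    mul A ∘ (s ⊠ idm A) = rmor (lmul s) ∘ lunit A.
  by rewrite /= -!compA lunitK comp_idr.
rewrite -!compA tens_swap tens_idr.
rewrite lmulE (comp_pre (lmulE _ _)) -[in RHS]compA lunit_nat compA -chi_lmul.
by symmetry; exact: compA.
Qed.

(** In elements, [r ⊗ s ↦ f(r) ⊗ s ↦ f(r) s ↦ 1 ⊗ f(r) s = r ⊗ s]. *)
Lemma ind_reg_counit (C : MonoidalCategory) (ce : Coequalizers C)
    (cf : forall X : C, Coflat X) (R S : Algebra C) (f : AlgHom R S) :
  rmod_comp (rmod_comp (ind_reg ce cf f) (counit ce cf f (reg S)))
    (ind_mor ce cf f (alghom_rmod f)) = rmod_id (ind_ob ce cf f (reg R)).
Proof.
apply: RModHom_eq; apply: (coeq_uniq (coeq_tensP ce (reg R) (restr f))).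
change (((ind_reg_mor ce f ∘ counit_mor ce f (reg S))
    ∘ coeq_tensm ce (alghom_rmod f) (restr f)) ∘ coeq_tens_map ce (reg R) (restr f)
  = idm _ ∘ coeq_tens_map ce (reg R) (restr f)).
rewrite comp_idl -compA coeq_tensmE -compA.
rewrite (comp_pre (counit_morE ce f (reg S))).
exact: ind_reg_restr_act.
Qed.

(** Naturality in the source pulls [f] inside [P], where [ind_reg_counit] leaves the identity.
    Writing it as an induced identity matches the defining equations of semiseparability and
    separability. *)
Lemma reg_retract_alghom (C : MonoidalCategory) (ce : Coequalizers C)
    (cf : forall X : C, Coflat X) (R S : Algebra C) (f : AlgHom R S)
    (P : hom_retrofamily (induction ce cf f)) :
  is_natural P ->
  rmod_comp (reg_retract P) (alghom_rmod f)
    = P (reg R) (reg R) (fmap (induction ce cf f) (idm (c := RMod R) (reg R))).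
Proof.
move=> Pnat; rewrite fmap_id.
have := Pnat (pull f (reg S)) (reg R) (reg R) (reg R)
  (alghom_rmod f) (idm (c := RMod R) (reg R))
  (rmod_comp (ind_reg ce cf f) (counit ce cf f (reg S))).
rewrite fmap_id !comp_idl => e; apply: (eq_trans (eq_sym e)).
exact: (f_equal (P (reg R) (reg R)) (ind_reg_counit ce cf f)).
Qed.

Lemma counit_alghom_ind_reg (C : MonoidalCategory) (ce : Coequalizers C)
    (R S : Algebra C) (f : AlgHom R S) :
  counit_mor ce f (reg S) ∘ coeq_tensm ce (alghom_rmod f) (restr f)
    ∘ ind_reg_mor ce f = idm S.
Proof.
rewrite /ind_reg_mor (comp_pre (coeq_tensmE ce (alghom_rmod f) (restr f))).
rewrite -compA (comp_pre (counit_morE ce f (reg S))).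
by have := restr_act_ind_reg f; rewrite /restr_act -compA.
Qed.

(** This carries equations between induced morphisms back to [S]: the composite on the left is
    [x ⊗ s ↦ f(u(x)) s], and [mul_inj] removes [s]. *)
Lemma eq_of_counit_ind_mor (C : MonoidalCategory) (ce : Coequalizers C)
    (R S : Algebra C) (f : AlgHom R S) (X : RightModule R)
    (u : RModHom X (reg R)) (v : hom X S) :
  counit_mor ce f (reg S) ∘ coeq_tensm ce (alghom_rmod f) (restr f)
    ∘ coeq_tensm ce u (restr f) ∘ coeq_tens_map ce X (restr f)
  = mul S ∘ (v ⊠ idm S) ->
  f ∘ rmor u = v.
Proof.
move=> e; apply: mul_inj; rewrite -e coeq_tensmE.
rewrite (comp_pre (coeq_tensmE ce (alghom_rmod f) (restr f))).
by rewrite -compA (comp_pre (counit_morE ce f (reg S))) tens_idr.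
Qed.

Lemma semiseparable_bimod (C : MonoidalCategory) (ce : Coequalizers C)
    (cf : forall X : C, Coflat X) (R S : Algebra C) (f : AlgHom R S) :
  left_tensor_generator (munit C) -> semiseparable (induction ce cf f) ->
  exists chi : hom S R, bimodule_map f chi /\ f ∘ chi ∘ f = f.
Proof.
move=> gen [P [Pnat PK]]; exists (rmor (reg_retract P)).
split; first exact: reg_retract_bimod.
(* At the identity, semiseparability says that [chi f] induces the identity; reading this in [S]
   gives [f chi f = f]. *)
have := PK (reg R) (reg R) (idm (c := RMod R) (reg R)).
rewrite -(reg_retract_alghom Pnat) fmap_id => /(f_equal (@rmor _ _ _ _)) e.
have {}e : coeq_tensm ce (rmod_comp (reg_retract P) (alghom_rmod f)) (restr f)
  = idm (coeq_tens ce (reg R) (restr f)) := e.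
apply: (eq_of_counit_ind_mor (ce := ce) (u := rmod_comp (reg_retract P) (alghom_rmod f))).
by rewrite e comp_idl; exact: (counit_ind_mor ce (alghom_rmod f)).
Qed.

Lemma separable_bimod (C : MonoidalCategory) (ce : Coequalizers C)
    (cf : forall X : C, Coflat X) (R S : Algebra C) (f : AlgHom R S) :
  left_tensor_generator (munit C) -> separable (induction ce cf f) ->
  exists chi : hom S R, bimodule_map f chi /\ chi ∘ f = idm R.
Proof.
move=> gen [P [Pnat PK]]; exists (rmor (reg_retract P)).
split; first exact: reg_retract_bimod.
have := PK (reg R) (reg R) (idm (c := RMod R) (reg R)).
by rewrite -(reg_retract_alghom Pnat) => /(f_equal (@rmor _ _ _ _)).
Qed.

Lemma naturally_full_bimod (C : MonoidalCategory) (ce : Coequalizers C)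
    (cf : forall X : C, Coflat X) (R S : Algebra C) (f : AlgHom R S) :
  left_tensor_generator (munit C) -> naturally_full (induction ce cf f) ->
  exists chi : hom S R, bimodule_map f chi /\ f ∘ chi = idm S.
Proof.
move=> gen [P [Pnat PK]]; exists (rmor (reg_retract P)).
split; first exact: reg_retract_bimod.
(* Natural fullness at the morphism defining [chi] says that [chi] induces exactly that morphism.
   Followed by the identification of [R ⊗_R S] with [S] it is the multiplication of [S], whence
   [f chi = id]. *)
have := PK (pull f (reg S)) (reg R)
  (rmod_comp (ind_reg ce cf f) (counit ce cf f (reg S))).
move/(f_equal (@rmor _ _ _ _)) => e.
have {}e : coeq_tensm ce (reg_retract P) (restr f)
  = ind_reg_mor ce f ∘ counit_mor ce f (reg S) := e.
apply: (eq_of_counit_ind_mor (ce := ce) (u := reg_retract P)).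
rewrite e tens_id comp_idr -(compA (ind_reg_mor ce f)).
rewrite (counit_morE ce f (reg S)).
have := comp_pre (counit_alghom_ind_reg ce f) (mul S).
by rewrite comp_idl -!compA.
Qed.

(** * Products of bimodule morphisms and the conclusion *)

Lemma pr1_prodm (C : Category) (fp : FiniteProducts C) (A A' B B' : C)
    (f : hom A A') (g : hom B B') :
  pr1 fp A' B' ∘ prodm fp f g = f ∘ pr1 fp A B.
Proof. exact: pr1_pair. Qed.

Lemma pr2_prodm (C : Category) (fp : FiniteProducts C) (A A' B B' : C)
    (f : hom A A') (g : hom B B') :
  pr2 fp A' B' ∘ prodm fp f g = g ∘ pr2 fp A B.
Proof. exact: pr2_pair. Qed.

Lemma prodm_comp (C : Category) (fp : FiniteProducts C)
    (A A' A'' B B' B'' : C) (f' : hom A' A'') (f : hom A A')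
    (g' : hom B' B'') (g : hom B B') :
  prodm fp f' g' ∘ prodm fp f g = prodm fp (f' ∘ f) (g' ∘ g).
Proof.
apply: pair_ext.
- by rewrite (comp_pre (pr1_prodm fp _ _)) -compA !pr1_prodm compA.
- by rewrite (comp_pre (pr2_prodm fp _ _)) -compA !pr2_prodm compA.
Qed.

Lemma prodm_id (C : Category) (fp : FiniteProducts C) (A B : C) :
  prodm fp (idm A) (idm B) = idm (bprod fp A B).
Proof.
by apply: pair_ext; rewrite /prodm ?pr1_pair ?pr2_pair comp_idl comp_idr.
Qed.

(** Equality into a product is tested on the two projections. These are multiplicative and commute
    with [prodm], so each component reduces to the linearity of [chi1] or [chi2]. *)
Lemma prodm_bimod (C : MonoidalCategory) (fp : FiniteProducts C)
    (R1 S1 R2 S2 : Algebra C) (f1 : AlgHom R1 S1) (f2 : AlgHom R2 S2)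
    (chi1 : hom S1 R1) (chi2 : hom S2 R2) :
  bimodule_map f1 chi1 -> bimodule_map f2 chi2 ->
  bimodule_map (prod_alghom fp f1 f2) (prodm fp chi1 chi2).
Proof.
move=> [l1 r1] [l2 r2]; split; apply: pair_ext.
- rewrite /restr_act /= (comp_pre (pr1_prodm fp _ _)) -(compA chi1).
  rewrite !(comp_pre (pr1_mul fp _ _)) -!(compA (mul _)) !tens_comp.
  (* Inserted identities let [pr1 ⊠ pr1] factor out on the right of both sides, exposing the
     linearity equation of [chi1]. *)
  rewrite !comp_idr !pr1_prodm -[pr1 fp R1 R2 in RHS]comp_idl.
  rewrite -[pr1 fp S1 S2 in LHS]comp_idl -!tens_comp.
  by rewrite -(comp_pre2 l1) /restr_act -!compA.
- rewrite /restr_act /= (comp_pre (pr2_prodm fp _ _)) -(compA chi2).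
  rewrite !(comp_pre (pr2_mul fp _ _)) -!(compA (mul _)) !tens_comp.
  rewrite !comp_idr !pr2_prodm -[pr2 fp R1 R2 in RHS]comp_idl.
  rewrite -[pr2 fp S1 S2 in LHS]comp_idl -!tens_comp.
  by rewrite -(comp_pre2 l2) /restr_act -!compA.
- rewrite /= (comp_pre (pr1_prodm fp _ _)) -(compA chi1).
  rewrite !(comp_pre (pr1_mul fp _ _)) -!(compA (mul _)) !tens_comp.
  rewrite !comp_idr !pr1_prodm -[pr1 fp R1 R2 in RHS]comp_idl.
  rewrite -[pr1 fp S1 S2 in LHS]comp_idl -!tens_comp.
  by rewrite -(comp_pre2 r1) -!compA.
- rewrite /= (comp_pre (pr2_prodm fp _ _)) -(compA chi2).
  rewrite !(comp_pre (pr2_mul fp _ _)) -!(compA (mul _)) !tens_comp.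
  rewrite !comp_idr !pr2_prodm -[pr2 fp R1 R2 in RHS]comp_idl.
  rewrite -[pr2 fp S1 S2 in LHS]comp_idl -!tens_comp.
  by rewrite -(comp_pre2 r2) -!compA.
Qed.

Theorem corollary5p3 (C : MonoidalCategory) (fp : FiniteProducts C)
    (gen : left_tensor_generator (munit C))
    (ce : Coequalizers C) (cf : forall X : C, Coflat X)
    (R1 S1 R2 S2 : Algebra C) (f1 : AlgHom R1 S1) (f2 : AlgHom R2 S2) :
  (semiseparable (induction ce cf f1) -> semiseparable (induction ce cf f2) ->
   semiseparable (induction ce cf (prod_alghom fp f1 f2))) /\
  (separable (induction ce cf f1) -> separable (induction ce cf f2) ->
   separable (induction ce cf (prod_alghom fp f1 f2))) /\
  (naturally_full (induction ce cf f1) ->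
   naturally_full (induction ce cf f2) ->
   naturally_full (induction ce cf (prod_alghom fp f1 f2))).
Proof.
split; [|split].
- move=> /(semiseparable_bimod gen) [chi1 [b1 e1]].
  move=> /(semiseparable_bimod gen) [chi2 [b2 e2]].
  apply: (bimod_semiseparable ce cf (prodm_bimod fp b1 b2)).
  by rewrite /= !prodm_comp e1 e2.
- move=> /(separable_bimod gen) [chi1 [b1 e1]].
  move=> /(separable_bimod gen) [chi2 [b2 e2]].
  apply: (bimod_separable ce cf (prodm_bimod fp b1 b2)).
  by rewrite /= prodm_comp e1 e2 prodm_id.
- move=> /(naturally_full_bimod gen) [chi1 [b1 e1]].
  move=> /(naturally_full_bimod gen) [chi2 [b2 e2]].
  apply: (bimod_naturally_full ce cf (prodm_bimod fp b1 b2)).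
  by rewrite /= prodm_comp e1 e2 prodm_id.
Qed.
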